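(* Assume the following conjectural statement of Poonen holds: for every integer $N\ge 4$, no quadratic polynomial in $\mathbb{Q}[z]$ has a rational periodic point of exact period $N$. Let $c_1,\dots,c_m\in\mathbb{Q}$ be pairwise distinct and let $f_i(z)=z^2+c_i$ for $i=1,\dots,m$. If some $q\in\mathbb{Q}$ is a periodic point of every map $f_i$, $i=1,\dots,m$, then $m\le 3$.
   Context: A point $P$ is periodic for a map $f$ if $f^n(P)=P$ for some $n>0$, where $f^n$ is the $n$-fold iterate; the smallest such $n$ is the exact period of $P$. *)

(* Defs.v *)
From mathcomp Require Import all_boot all_order all_algebra.

Set Implicit Arguments.
Unset Strict Implicit.
Unset Printing Implicit Defensive.

Import GRing.Theory.
Local Open Scope ring_scope.

Definition periodic_point (T : Type) (f : T -> T) (P : T) : Prop :=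
  exists2 n : nat, (0 < n)%N & iter n f P = P.

Definition exact_period (T : Type) (f : T -> T) (n : nat) (P : T) : Prop :=
  [/\ (0 < n)%N, iter n f P = P
    & forall k : nat, (0 < k)%N -> iter k f P = P -> (n <= k)%N].

(* [size p = 3] says that p has degree exactly 2. *)
Definition poonen_conjecture : Prop :=
  forall N : nat, (4 <= N)%N ->
  forall p : {poly rat}, size p = 3%N ->
  ~ exists x : rat, exact_period (horner p) N x.

(* Main.v *)
(** By Poonen's conjecture [q] has exact period 1, 2 or 3 for each [z^2 + c].
    Period 1 forces [c = q - q^2] and period 2 forces [c = - q^2 - q - 1], so
    it suffices that period 3 occurs for at most one [c].  Period 3 makes
    [t = q + f(q)] a root of the cubic [t^3 + a t^2 + (a - 1) t + 1] with
    [a = 2 - 2 q].  If this cubic had two distinct rational roots it would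
    split, and for a root [t] the discriminant of the remaining quadratic
    factor gives a rational point on [y^2 = t^4 + 6 t^3 + 7 t^2 + 2 t + 1],
    that is, with [v = (t + 2) / t], on [w^2 = v^4 + 22 v^2 - 7].  This is an
    elliptic curve of conductor 14 and rank 0; a descent by 2-isogeny shows
    that [v = 1] or [v = -1], which no root [t] satisfies. *)

Require Import Defs.
From mathcomp Require Import all_boot all_order all_algebra.
From mathcomp Require Import zify ring lra.

Set Implicit Arguments.
Unset Strict Implicit.
Unset Printing Implicit Defensive.

(** * Coprime factors of perfect powers *)

Lemma gcdn_exp (k m n : nat) : gcdn (m ^ k) (n ^ k) = gcdn m n ^ k.
Proof.
have [g0|g_gt0] := posnP (gcdn m n).
  have [-> ->] : m = 0 /\ n = 0.
    move: g0 => /eqP; rewrite -leqn0 leqNgt gcdn_gt0 negb_or -!eqn0Ngt.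
    by case/andP=> /eqP-> /eqP->.
  by rewrite gcdnn gcd0n.
have [m' Em] : exists m', m = gcdn m n * m'.
  by exists (m %/ gcdn m n); rewrite mulnC divnK ?dvdn_gcdl.
have [n' En] : exists n', n = gcdn m n * n'.
  by exists (n %/ gcdn m n); rewrite mulnC divnK ?dvdn_gcdr.
have co : coprime m' n'.
  by rewrite /coprime -(eqn_pmul2l g_gt0) muln_gcdr -Em -En muln1.
rewrite {1}Em {2}En !expnMn -muln_gcdr.
have /eqP-> : coprime (m' ^ k) (n' ^ k) by rewrite coprimeXl ?coprimeXr.
by rewrite muln1.
Qed.

(** The root of [u] is [gcdn u w]: its [k]-th power is [gcdn (u ^ k) (u * v)], which [u] divides;
    conversely that power divides [u * v] and is coprime to [v]. *)
Lemma coprime_mul_exp (k u v w : nat) : 0 < k -> coprime u v ->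
  u * v = w ^ k -> exists r s, [/\ u = r ^ k, v = s ^ k & w = r * s].
Proof.
move=> k_gt0.
have root x y : coprime x y -> x * y = w ^ k -> x = gcdn x w ^ k.
  move=> co E; apply/eqP; rewrite eqn_dvd -{1}gcdn_exp dvdn_gcd -E.
  rewrite dvdn_exp //= dvdn_mulr //=.
  rewrite -(@Gauss_dvdl _ _ y) ?E ?dvdn_exp2r ?dvdn_gcdr //.
  by rewrite coprimeXl // (coprime_dvdl (dvdn_gcdl _ _) co).
move=> co E; have Eu := root _ _ co E.
have Ev : v = gcdn v w ^ k by apply: (root v u); rewrite 1?coprime_sym // mulnC.
exists (gcdn u w), (gcdn v w); split=> //.
by apply/eqP; rewrite -(eqn_exp2r _ _ k_gt0) expnMn -Eu -Ev E.
Qed.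

Lemma coprime_mul_prime_exp (p k u v w : nat) :
  prime p -> 0 < k -> coprime u v -> u * v = p * w ^ k ->
  exists r s, w = r * s /\
    (u = p * r ^ k /\ v = s ^ k \/ v = p * r ^ k /\ u = s ^ k).
Proof.
move=> p_pr k_gt0.
have wlog_dvd x y : coprime x y -> x * y = p * w ^ k -> p %| x ->
    exists r s, [/\ x = p * r ^ k, y = s ^ k & w = r * s].
  move=> co E /dvdnP[x' Ex]; rewrite {}Ex in co E *.
  have co' : coprime x' y by apply: coprime_dvdl co; rewrite dvdn_mulr.
  have E' : x' * y = w ^ k.
    by apply/eqP; rewrite -(eqn_pmul2l (prime_gt0 p_pr)) mulnA [p * x']mulnC E.
  have [r [s [-> -> ->]]] := coprime_mul_exp k_gt0 co' E'.
  by exists r, s; rewrite mulnC.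
move=> co E; have: p %| u * v by rewrite E dvdn_mulr.
rewrite (Euclid_dvdM _ _ p_pr) => /orP[] p_dvd.
  by have [r [s [-> -> ->]]] := wlog_dvd _ _ co E p_dvd; exists r, s; split; [|left].
rewrite coprime_sym in co; rewrite mulnC in E.
by have [r [s [-> -> ->]]] := wlog_dvd _ _ co E p_dvd; exists r, s; split; [|right].
Qed.

Lemma coprime_mul_pow2_exp (j k u v w : nat) :
  0 < k -> coprime u v -> odd v -> u * v = 2 ^ j * w ^ k ->
  exists r s, [/\ u = 2 ^ j * r ^ k, v = s ^ k & w = r * s].
Proof.
move=> k_gt0 co v_odd E.
have : 2 ^ j %| u by rewrite -(@Gauss_dvdl _ _ v) ?E ?dvdn_mulr // coprimeXl ?coprime2n.
case/dvdnP=> u' Eu; rewrite {}Eu in co E *.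
have co' : coprime u' v by apply: coprime_dvdl co; rewrite dvdn_mulr.
have E' : u' * v = w ^ k.
  by apply/eqP; rewrite -(@eqn_pmul2l (2 ^ j)) ?expn_gt0 // mulnA [2 ^ j * u']mulnC E.
by have [r [s [-> -> ->]]] := coprime_mul_exp k_gt0 co' E';
  exists r, s; rewrite mulnC.
Qed.

(** This is [m^2 - (a - b)^2 = 4 k] without subtraction. The factors are [(m - (a - b)) / 2] and
    [(m + (a - b)) / 2], integral because [m] and [a - b] have the same parity. *)
Lemma square_diff_factor (m a b k : nat) :
  m ^ 2 + 2 * (a * b) = a ^ 2 + b ^ 2 + 4 * k ->
  exists u v, [/\ u + v = m, u * v = k & v + b = u + a].
Proof.
have wlog_le x y : y <= x -> m ^ 2 + 2 * (x * y) = x ^ 2 + y ^ 2 + 4 * k ->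
    exists u v, [/\ u + v = m, u * v = k & v + y = u + x].
  move=> le_yx E; set d := x - y.
  have Ex : x = d + y by rewrite subnK.
  have Em : m ^ 2 = d ^ 2 + 4 * k by move: E; rewrite Ex; lia.
  have le_dm : d <= m by rewrite -leq_sqr; lia.
  have par : odd m = odd d.
    have := congr1 odd Em; rewrite oddD oddM /= addbF !oddX /=; done.
  have [u Eu] : exists u, m = d + 2 * u.
    exists (m - d)./2; rewrite mul2n even_halfK ?subnKC // oddB // par addbb //.
  exists u, (u + d); split; [lia| |lia].
  move: Em; rewrite Eu; nia.
case: (leqP b a) => [le_ba|/ltnW le_ab] E; first exact: wlog_le.
have [u [v [E1 E2 E3]]] := wlog_le b a le_ab ltac:(lia).
by exists v, u; split; lia.
Qed.

(** * Squares modulo powers of 2 *)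

Lemma odd_square (x : nat) : odd x -> exists j, x ^ 2 = 8 * j + 1.
Proof.
move=> x_odd; have [k ->] : exists k, x = 2 * k + 1 by exists x./2; lia.
have [j Ej] : exists j, k * (k + 1) = 2 * j.
  by exists (k * (k + 1))./2; rewrite mul2n even_halfK // oddM oddD /= addbT andbN.
by exists j; nia.
Qed.

Lemma even_square (x : nat) : ~~ odd x -> exists j, x ^ 2 = 4 * j.
Proof. by move=> x_even; exists (x./2 ^ 2); rewrite -{1}(even_halfK x_even); lia. Qed.

(** Every choice of parities of [m] and [n] fails modulo 4. This rules out one of the two ways to
    place the factor 7 in the descent. *)
Lemma no_twisted_odd (r m n : nat) : odd r ->
  r ^ 2 + n ^ 4 = 22 * (m ^ 2 * n ^ 2) + 7 * m ^ 4 -> False.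
Proof.
rewrite (expnM n 2 2) (expnM m 2 2) => /odd_square[i ->].
case: (boolP (odd m)) => [/odd_square|/even_square] [j ->];
  case: (boolP (odd n)) => [/odd_square|/even_square] [l ->]; lia.
Qed.

(** Modulo 8 the sides are 1 and 5. *)
Lemma no_twisted_16 (r m n : nat) : odd m -> odd n ->
  16 * r ^ 2 + n ^ 4 = 22 * (m ^ 2 * n ^ 2) + 7 * m ^ 4 -> False.
Proof. by rewrite (expnM n 2 2) (expnM m 2 2) =>
  /odd_square[j ->] /odd_square[l ->]; lia. Qed.

(** * Prime divisors and the 2-isogeny descent *)

Lemma prime_coprime_intro (u v : nat) :
  (forall p, prime p -> p %| u -> p %| v -> False) -> coprime u v.
Proof.
move=> no_p; rewrite /coprime eqn_leq gcdn_gt0 leqNgt; apply/andP; split.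
  apply/negP=> /pdiv_prime pr.
  by have := pdiv_dvd (gcdn u v); rewrite dvdn_gcd => /andP[]; apply: no_p.
by case: u v no_p => [|u] [|v] // /(_ 2) [].
Qed.

(** The prime [q] can absorb only one of the two factors [p] of [u * v]. *)
Lemma prime_dvd_mul_prime_exp (p q k u v w : nat) :
  prime p -> prime q -> p %| u -> p %| v -> u * v = q * w ^ k -> p %| w.
Proof.
move=> p_pr q_pr pu pv E.
have pp : p * p %| q * w ^ k by rewrite -E dvdn_mul.
suff : p %| w ^ k by rewrite Euclid_dvdX // => /andP[].
have [Epq|neq] := eqVneq p q.
  by move: pp; rewrite Epq dvdn_pmul2l // prime_gt0.
rewrite -(@Gauss_dvdr p q) ?(dvdn_trans (dvdn_mulr p (dvdnn p)) pp) //.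
by rewrite prime_coprime // dvdn_prime2.
Qed.

Lemma prime_dvd_sqr (p x : nat) : prime p -> p %| x ^ 2 -> p %| x.
Proof. by move=> p_pr; rewrite Euclid_dvdX // => /andP[]. Qed.

Lemma coprime_prime (p x y : nat) : prime p -> coprime x y ->
  p %| x -> p %| y -> False.
Proof.
move=> p_pr co px py; have : p %| gcdn x y by rewrite dvdn_gcd px.
by rewrite (eqP co) dvdn1 => /eqP p1; rewrite p1 in p_pr.
Qed.

(* [n^2 = m^4 + 22 m^2 e^2 - 7 e^4] and [m^2 = r^4 - 11 r^2 s^2 + 32 s^4] are
   2-coverings of 2-isogenous elliptic curves; the second one appears in two
   forms according to the parity of [s]. Here
   [(m^2 + 11 e^2)^2 - n^2 = 128 e^4] is factored. *)
Lemma descent_to_dual (m n e : nat) : coprime m e ->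
  n ^ 2 + 7 * e ^ 4 = m ^ 4 + 22 * (m ^ 2 * e ^ 2) ->
  exists r s, [/\ e = r * s, coprime r s &
   ([/\ odd r, ~~ odd s & m ^ 2 + 11 * (r ^ 2 * s ^ 2) = r ^ 4 + 32 * s ^ 4] \/
    [/\ odd r, odd s & m ^ 2 + 11 * (r ^ 2 * s ^ 2) = 4 * r ^ 4 + 8 * s ^ 4])].
Proof.
move=> co E.
have [u [v [E1 E2 _]]] : exists u v,
    [/\ u + v = m ^ 2 + 11 * e ^ 2, u * v = 32 * e ^ 4 & v + 0 = u + n].
  by apply: square_diff_factor; move: E; clear; lia.
have dvd_e p : prime p -> p %| m ^ 2 + 11 * e ^ 2 -> p %| e -> False.
  move=> p_pr dvd pe; apply: (coprime_prime p_pr co _ pe).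
  apply: prime_dvd_sqr => //; move: dvd; rewrite dvdn_addl //.
  by rewrite dvdn_mull // dvdn_exp.
(* Odd sum: one of [u], [v] is odd and they are coprime, so they are [r^4] and [32 s^4]. *)
have [S_odd|S_even] := boolP (odd (m ^ 2 + 11 * e ^ 2)).
  have key x y : x + y = m ^ 2 + 11 * e ^ 2 -> x * y = 32 * e ^ 4 -> odd y ->
      exists r s, [/\ e = r * s, odd r, coprime r s &
          m ^ 2 + 11 * (r ^ 2 * s ^ 2) = r ^ 4 + 32 * s ^ 4].
    move=> F1 F2 y_odd.
    have co_xy : coprime x y.
      apply: prime_coprime_intro => p p_pr px py.
      have : p %| 2 ^ 5 * e ^ 4 by rewrite -[2 ^ 5]/32 -F2 dvdn_mulr.
      rewrite Euclid_dvdM // !Euclid_dvdX // => /orP[] /andP[pd _].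
        by move: pd py; rewrite dvdn_prime2 // => /eqP->; rewrite dvdn2 y_odd.
      by apply: dvd_e pd => //; rewrite -F1 dvdn_add.
    have [s [r [Ex Ey Ee]]] :=
      coprime_mul_pow2_exp (j := 5) (isT : 0 < 4) co_xy y_odd F2.
    exists r, s; split; [by rewrite mulnC | | |].
      by move: y_odd; rewrite Ey oddX.
      move: co_xy; rewrite Ex Ey coprimeMl => /andP[_].
      by rewrite coprime_pexpl // coprime_pexpr // coprime_sym.
    by move: F1; rewrite Ex Ey Ee !expnMn; clear;
       move: (r ^ 4) (s ^ 4) (r ^ 2) (s ^ 2) => *; lia.
  have [r [s [Ee r_odd co_rs Em]]] : exists r s,
      [/\ e = r * s, odd r, coprime r s &
          m ^ 2 + 11 * (r ^ 2 * s ^ 2) = r ^ 4 + 32 * s ^ 4].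
    have [v_odd|v_even] := boolP (odd v); first exact: key E2 v_odd.
    apply: (key v u); [by rewrite addnC | by rewrite mulnC |].
    by move: S_odd; rewrite -E1 oddD (negPf v_even) addbF.
  (* An odd [s] would make [m] even, and the equation would fail modulo 4. *)
  exists r, s; split=> //; left; split=> //; apply/negP=> s_odd.
  have e_odd : odd e by rewrite Ee oddM r_odd.
  have m_even : ~~ odd m.
    by move: S_odd; rewrite oddD oddM !oddX /= e_odd addbT.
  case/even_square: m_even Em => a ->; case/odd_square: r_odd => b Eb.
  case/odd_square: s_odd => d Ed.
  by rewrite (expnM r 2 2) (expnM s 2 2) Eb Ed; clear; lia.
(* Even sum: it is [4 k] with [k] odd, and 4 divides both [u] and [v]. Their quarters have sum [k]
   and product [2 e^4], so they are [r^4] and [2 s^4]. *)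
have [m_odd e_odd] : odd m /\ odd e.
  move: S_even; rewrite oddD oddM !oddX /=.
  case: (boolP (odd m)); case: (boolP (odd e)) => // e_even m_even _.
  by exfalso; apply: (@coprime_prime 2 m e); rewrite ?dvdn2.
have [k Ek k_odd] : exists2 k, m ^ 2 + 11 * e ^ 2 = 4 * k & odd k.
  case/odd_square: m_odd => a ->; case/odd_square: e_odd => b ->.
  by exists (2 * a + 22 * b + 3); lia.
have [x [y [F1 F2]]] : exists x y, x + y = k /\ x * y = 2 * e ^ 4.
  have par_uv x y : x + y = 4 * k -> x * y = 32 * e ^ 4 -> ~~ odd x.
    move=> F1 F2; apply/negP=> x_odd.
    have := congr1 odd F1; have := congr1 odd F2.
    by rewrite !(oddD, oddM) /= x_odd /= => ->.
  have u_even := par_uv _ _ (etrans E1 Ek) E2.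
  have v_even : ~~ odd v by apply: (par_uv v u); lia.
  have [u1 Eu] : exists u1, u = 2 * u1 by exists u./2; lia.
  have [v1 Ev] : exists v1, v = 2 * v1 by exists v./2; lia.
  rewrite {}Eu {}Ev in E1 E2.
  have G1 : u1 + v1 = 2 * k by lia.
  have G2 : u1 * v1 = 8 * e ^ 4 by lia.
  have ev : ~~ odd u1 /\ ~~ odd v1.
    have := congr1 odd G1; have := congr1 odd G2; rewrite !(oddD, oddM) /=.
    by case: (odd u1); case: (odd v1).
  exists u1./2, v1./2; case: ev => eu ev.
  have Eu : u1 = 2 * u1./2 by lia.
  have Ev : v1 = 2 * v1./2 by lia.
  by move: G1 G2; rewrite {1 3}Eu {1 2}Ev; split; lia.
have key x' y' : x' + y' = k -> x' * y' = 2 * e ^ 4 -> odd y' ->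
    exists r s, [/\ e = r * s, coprime r s & k = r ^ 4 + 2 * s ^ 4].
  move=> G1 G2 y_odd.
  have co_xy : coprime x' y'.
    apply: prime_coprime_intro => p p_pr px py.
    apply: (dvd_e p) => //; last exact: prime_dvd_mul_prime_exp px py G2.
    by rewrite Ek -G1 dvdn_mull // dvdn_add.
  have [s [r [Ex Ey Ee]]] :=
    coprime_mul_pow2_exp (j := 1) (isT : 0 < 4) co_xy y_odd G2.
  exists r, s; split; [by rewrite mulnC | | by rewrite -G1 Ex Ey addnC].
    move: co_xy; rewrite Ex Ey coprimeMl => /andP[_].
    by rewrite coprime_pexpl // coprime_pexpr // coprime_sym.
have [r [s [Ee co_rs Er]]] : exists r s,
    [/\ e = r * s, coprime r s & k = r ^ 4 + 2 * s ^ 4].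
  have [y_odd|y_even] := boolP (odd y); first exact: key F2 y_odd.
  apply: (key y x); [by rewrite addnC | by rewrite mulnC |].
  by move: k_odd; rewrite -F1 oddD (negPf y_even) addbF.
have := e_odd; rewrite Ee oddM => /andP[r_odd s_odd].
exists r, s; split=> //; right; split=> //.
by move: Ek; rewrite Er Ee !expnMn; clear;
   move: (r ^ 4) (s ^ 4) (r ^ 2) (s ^ 2) => *; lia.
Qed.

(* [m^2 - (r^2 - 22 t^2)^2 = 28 t^4], where [s = 2 t], is factored. *)
Lemma descent_back_even (m r s : nat) : odd r -> ~~ odd s -> coprime r s ->
  m ^ 2 + 11 * (r ^ 2 * s ^ 2) = r ^ 4 + 32 * s ^ 4 ->
  exists a b, [/\ s = 2 * (a * b), coprime a b &
    r ^ 2 + 7 * b ^ 4 = a ^ 4 + 22 * (a ^ 2 * b ^ 2)].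
Proof.
move=> r_odd s_even co.
have [t Es] : exists t, s = 2 * t by exists s./2; lia.
rewrite {s s_even}Es in co * => E.
have [u [v [E1 E2 E3]]] : exists u v,
    [/\ u + v = m, u * v = 7 * t ^ 4 & v + 22 * t ^ 2 = u + r ^ 2].
  apply: square_diff_factor; move: E.
    rewrite !expnMn (expnM r 2 2) (expnM t 2 2); clear.
    by move: (r ^ 2) (t ^ 2) (m ^ 2) => *; lia.
have co_rt : coprime r t by apply: coprime_dvdr co; rewrite dvdn_mull.
have co_uv : coprime u v.
  apply: prime_coprime_intro => p p_pr pu pv.
  have pt : p %| t by apply: prime_dvd_mul_prime_exp pu pv E2.
  apply: (coprime_prime p_pr co_rt _ pt); apply: prime_dvd_sqr => //.
  by rewrite -(dvdn_addr _ pu) -E3 dvdn_add // dvdn_mull // dvdn_exp.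
have [b [a [Et]]] :=
  coprime_mul_prime_exp (isT : prime 7) (isT : 0 < 4) co_uv E2.
case=> -[Eu Ev]; last first.
  exfalso; apply: (@no_twisted_odd r b a) => //.
  by move: E3; rewrite Et Eu Ev !expnMn; clear; move: (a ^ 4) (b ^ 4) (a ^ 2) (b ^ 2) => *; lia.
exists a, b; split; [by rewrite Et [b * a]mulnC | | ]; last first.
  by move: E3; rewrite Et Eu Ev !expnMn; clear; move: (a ^ 4) (b ^ 4) (a ^ 2) (b ^ 2) => *; lia.
move: co_uv; rewrite Eu Ev coprimeMl => /andP[_].
by rewrite coprime_pexpl // coprime_pexpr // coprime_sym.
Qed.

(* [(8 m)^2 - (16 r^2 - 22 s^2)^2 = 28 s^4] is factored. *)
Lemma descent_back_odd (m r s : nat) : odd r -> odd s -> coprime r s ->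
  m ^ 2 + 11 * (r ^ 2 * s ^ 2) = 4 * r ^ 4 + 8 * s ^ 4 ->
  exists a b, [/\ s = a * b, coprime a b &
    (4 * r) ^ 2 + 7 * b ^ 4 = a ^ 4 + 22 * (a ^ 2 * b ^ 2)].
Proof.
move=> r_odd s_odd co E.
have [u [v [E1 E2 E3]]] : exists u v,
    [/\ u + v = 8 * m, u * v = 7 * s ^ 4 & v + 22 * s ^ 2 = u + 16 * r ^ 2].
  apply: square_diff_factor; move: E.
    rewrite !expnMn (expnM r 2 2) (expnM s 2 2); clear.
    by move: (r ^ 2) (s ^ 2) (m ^ 2) => *; lia.
have co_uv : coprime u v.
  apply: prime_coprime_intro => p p_pr pu pv.
  have ps : p %| s by apply: prime_dvd_mul_prime_exp pu pv E2.
  apply: (coprime_prime p_pr co _ ps); apply: prime_dvd_sqr => //.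
  have : p %| 2 ^ 4 * r ^ 2.
    by rewrite -[2 ^ 4]/16 -(dvdn_addr _ pu) -E3 dvdn_add // dvdn_mull // dvdn_exp.
  rewrite Euclid_dvdM // Euclid_dvdX // => /orP[/andP[]|//].
  by rewrite dvdn_prime2 // => /eqP p2; move: ps; rewrite p2 dvdn2 s_odd.
have [b [a [Es]]] :=
  coprime_mul_prime_exp (isT : prime 7) (isT : 0 < 4) co_uv E2.
case=> -[Eu Ev]; last first.
  have := s_odd; rewrite Es oddM => /andP[b_odd a_odd].
  exfalso; apply: (@no_twisted_16 r b a) => //.
  by move: E3; rewrite Es Eu Ev !expnMn; clear; move: (a ^ 4) (b ^ 4) (a ^ 2) (b ^ 2) => *; lia.
exists a, b; split; [by rewrite Es mulnC | | ]; last first.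
  by move: E3; rewrite Es Eu Ev !expnMn; clear; move: (a ^ 4) (b ^ 4) (a ^ 2) (b ^ 2) => *; lia.
move: co_uv; rewrite Eu Ev coprimeMl => /andP[_].
by rewrite coprime_pexpl // coprime_pexpr // coprime_sym.
Qed.

(** Infinite descent on [e]: passing to the dual covering and back gives a solution with last
    coordinate [b], where [e = r * s] and [s] is [a * b] or [2 * (a * b)]. *)
Lemma quartic_descent (m n e : nat) : 0 < e -> coprime m e ->
  n ^ 2 + 7 * e ^ 4 = m ^ 4 + 22 * (m ^ 2 * e ^ 2) -> m = 1 /\ e = 1.
Proof.
elim/ltn_ind: e m n => e IH m n e_gt0 co E.
have [r [s [Ee co_rs]]] := descent_to_dual co E.
have [r_gt0 s_gt0] : 0 < r /\ 0 < s by apply/andP; rewrite -muln_gt0 -Ee.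
have le_se : s <= e by rewrite Ee leq_pmull.
case=> -[r_odd s_par Em].
  have [a [b [Es co_ab Er]]] := descent_back_even r_odd s_par co_rs Em.
  have [a_gt0 b_gt0] : 0 < a /\ 0 < b.
    by apply/andP; rewrite -muln_gt0; move: s_gt0; rewrite Es; case: (a * b).
  have le_bs : b * 2 <= s by rewrite Es mulnC leq_pmul2l // leq_pmull.
  have [a1 b1] : a = 1 /\ b = 1 by apply: IH co_ab Er => //; lia.
  have r16 : r ^ 2 = 16 by move: Er; rewrite a1 b1; lia.
  by have := congr1 odd r16; rewrite oddX r_odd.
have [a [b [Es co_ab Er]]] := descent_back_odd r_odd s_par co_rs Em.
have [a_gt0 b_gt0] : 0 < a /\ 0 < b by apply/andP; rewrite -muln_gt0 -Es.
have le_bs : b <= s by rewrite Es leq_pmull.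
(* The descent stalls only at [b = e]; then [a = r = 1] and the equation becomes
   [(e^2 - 1) (7 e^2 - 15) = 0]. *)
have [b_eq|b_lt] := eqVneq b e; last first.
  have [a1 b1] : a = 1 /\ b = 1 by apply: IH co_ab Er => //; lia.
  have r1 : r = 1 by move: Er; rewrite a1 b1; nia.
  by move: b_lt; rewrite Ee r1 Es a1 b1.
have s_eq : s = e by lia.
have a1 : a = 1.
  by apply/eqP; rewrite -(eqn_pmul2r e_gt0) mul1n -{1}b_eq -Es s_eq.
have r1 : r = 1.
  by apply/eqP; rewrite -(eqn_pmul2r e_gt0) mul1n -{1}s_eq -Ee.
have e1 : e = 1.
  have Ee2 : 15 + 7 * (e ^ 2) ^ 2 = 22 * e ^ 2.
    by move: Er; rewrite a1 r1 b_eq (expnM e 2 2); clear; lia.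
  have e2 : e ^ 2 = 1 by move: Ee2; clear; move: (e ^ 2) => x; nia.
  by apply/eqP; rewrite -(@eqn_exp2r e 1 2) // e2.
split=> //; apply/eqP; rewrite -(@eqn_exp2r m 1 2) //; apply/eqP.
by move: Em; rewrite r1 s_eq e1; lia.
Qed.

(** * Rational points on the quartic *)

Import Order.TTheory GRing.Theory Num.Theory.
Local Open Scope ring_scope.

Lemma sqr_rat_int (x : rat) (n : int) : x ^+ 2 = n%:~R -> exists k : int, x = k%:~R.
Proof.
move=> E; exists (numq x); rewrite -[LHS]divq_num_den.
suff -> : denq x = 1 by rewrite divr1.
have num2 : numq x ^+ 2 = n * denq x ^+ 2.
  apply: (@intr_inj rat); rewrite rmorphXn rmorphM rmorphXn /= -E -exprMn; congr (_ ^+ 2).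
  exact: numqE.
have dvd : (`|denq x| %| `|numq x| ^ 2)%N.
  by rewrite -abszX num2 abszM abszX dvdn_mull // dvdn_exp.
have co := coprime_num_den x.
have : `|denq x|%N = 1%N.
  apply/eqP; rewrite -dvdn1 -(@Gauss_dvdr _ (`|numq x| ^ 2)) ?muln1 //.
  by rewrite coprimeXr // coprime_sym.
by have := denq_gt0 x; lia.
Qed.

(** With [v = m / e] in lowest terms, [w * e^2] has an integer square, hence is an integer, and
    [quartic_descent] applies to absolute values. *)
Lemma rat_quartic_points (v w : rat) :
  w ^+ 2 = v ^+ 4 + 22 * v ^+ 2 - 7 -> v ^+ 2 = 1.
Proof.
move=> E; set m := numq v; set e := denq v.
have e_neq0 : (e%:~R : rat) != 0 by rewrite intr_eq0 denq_neq0.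
have Ev : v = m%:~R / e%:~R by rewrite divq_num_den.
have Ew : (w * e%:~R ^+ 2) ^+ 2 = (m ^+ 4 + 22 * (m ^+ 2 * e ^+ 2) - 7 * e ^+ 4)%:~R.
  rewrite exprMn E Ev; rewrite rmorphB rmorphD !rmorphM ?rmorphXn /=.
  by field.
have [k Ek] := sqr_rat_int Ew.
have Enum : k ^+ 2 + 7 * e ^+ 4 = m ^+ 4 + 22 * (m ^+ 2 * e ^+ 2).
  apply: (@intr_inj rat); move: Ew; rewrite Ek -rmorphXn => /intr_inj ->.
  by rewrite subrK.
have [m1 e1] : `|m|%N = 1%N /\ `|e|%N = 1%N.
  apply: (@quartic_descent _ `|k|%N); first by rewrite absz_gt0 denq_neq0.
    exact: coprime_num_den.
  have sq (x : int) : (Posz `|x|) ^+ 2 = x ^+ 2 by rewrite abszE real_normK ?num_real.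
  have sq4 (x : int) : (Posz `|x|) ^+ 4 = x ^+ 4 by rewrite (exprM _ 2 2) sq -exprM.
  move: Enum; rewrite -(sq k) -(sq m) -(sq e) -(sq4 m) -(sq4 e); clear; lia.
have e_eq : e = 1 by have := denq_gt0 v; rewrite -/e; lia.
rewrite Ev e_eq divr1 -rmorphXn /=.
have -> : m ^+ 2 = 1 by have [->|->] : m = 1 \/ m = -1 by lia.
by [].
Qed.

(** * The cubic attached to period 3 *)

Lemma two_roots_quartic_square (F : fieldType) (a t s : F) : t != s ->
  t ^+ 3 + a * t ^+ 2 + (a - 1) * t + 1 = 0 ->
  s ^+ 3 + a * s ^+ 2 + (a - 1) * s + 1 = 0 ->
  exists y, y ^+ 2 = t ^+ 4 + 6 * t ^+ 3 + 7 * t ^+ 2 + 2 * t + 1.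
Proof.
move=> neq Et Es.
(* [s] is a root of the quotient of the cubic by [X - t]. *)
have Q : t ^+ 2 + t * s + s ^+ 2 + a * (t + s) + (a - 1) = 0.
  have /eqP : (t - s) * (t ^+ 2 + t * s + s ^+ 2 + a * (t + s) + (a - 1)) = 0.
    by rewrite -[RHS](subrr (0 : F)) -{1}Et -Es; ring.
  by rewrite mulf_eq0 subr_eq0 (negPf neq) => /eqP.
(* The third root is [- a - t - s], so [2 * s + a + t] is the difference of
   the two roots other than [t]. *)
exists (t * (t + 1) * (2 * s + a + t)).
set P := (X in X = 0) in Et; set S := (X in X = 0) in Q.
(* The multiple of [S] turns [(2 s + a + t)^2] into the discriminant of that quotient; the multiple
   of [P] then eliminates [a] through [t (t + 1) a = t - 1 - t^3]. *)
transitivity (t ^+ 4 + 6 * t ^+ 3 + 7 * t ^+ 2 + 2 * t + 1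
  + 4 * t ^+ 2 * (t + 1) ^+ 2 * S
  + P * (P + 2 * (t ^+ 2 + t - 1) - 4 * t * (t + 1) ^+ 2)).
  by rewrite /P /S; ring.
by rewrite Et Q; ring.
Qed.

Lemma cubic_unique_root (a t s : rat) :
  t ^+ 3 + a * t ^+ 2 + (a - 1) * t + 1 = 0 ->
  s ^+ 3 + a * s ^+ 2 + (a - 1) * s + 1 = 0 -> t = s.
Proof.
move=> Et Es; apply/eqP/negPn/negP=> neq.
have [y Ey] := two_roots_quartic_square neq Et Es.
have t_neq0 : t != 0 by apply/eqP=> t0; move: Et; rewrite t0; lra.
(* With [v = (t + 2) / t], [t^4 (v^4 + 22 v^2 - 7)] is 16 times the quartic in [t], whence
   [w = 4 y / t^2]. *)
have := @rat_quartic_points ((t + 2) / t) (4 * y / t ^+ 2).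
have -> : (4 * y / t ^+ 2) ^+ 2 = ((t + 2) / t) ^+ 4 + 22 * ((t + 2) / t) ^+ 2 - 7.
  transitivity (16 * y ^+ 2 / t ^+ 4); first by field.
  by rewrite Ey; field.
move=> /(_ erefl) v1.
(* [v = 1] is impossible and [v = -1] gives [t = -1], where the cubic has value 1. *)
have t1 : t = -1.
  have : (t + 2) ^+ 2 = t ^+ 2 by rewrite -[t + 2](divfK t_neq0) exprMn v1 mul1r.
  by move=> H; nra.
by move: Et; rewrite t1; lra.
Qed.

(** The cubic is the third dynatomic polynomial, [(f^3(q) - q) / (f(q) - q)], with [c] replaced by
    [t - q - q^2]; its coefficients then depend on [q] alone. *)
Lemma period3_trace_root (q c : rat) : let f z := z ^+ 2 + c in
  f q != q -> f (f (f q)) = q ->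
  let t := q + f q in
  t ^+ 3 + (2 - 2 * q) * t ^+ 2 + (2 - 2 * q - 1) * t + 1 = 0.
Proof.
move=> f nfix per t.
have key : (f q - q) * (t ^+ 3 + (2 - 2 * q) * t ^+ 2 + (2 - 2 * q - 1) * t + 1) = 0.
  transitivity (f (f (f q)) - q); last by rewrite per subrr.
  rewrite /t /f; ring.
by move/eqP: key; rewrite mulf_eq0 subr_eq0 (negPf nfix) => /eqP.
Qed.

(** * Periods at most 3 and the count of maps *)

Lemma periodic_point_exact (T : eqType) (f : T -> T) (x : T) :
  periodic_point f x -> exists n, exact_period f n x.
Proof.
case=> n n_gt0 fx.
have ex : exists k, (0 < k)%N && (iter k f x == x).
  by exists n; rewrite n_gt0 fx eqxx.
case: (ex_minnP ex) => k /andP[k_gt0 /eqP fk] min_k.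
by exists k; split=> // j j_gt0 fj; apply: min_k; rewrite j_gt0 fj eqxx.
Qed.

Lemma poonen_period_le3 (c q : rat) : poonen_conjecture ->
  periodic_point (fun z => z ^+ 2 + c) q ->
  exists2 n, (n <= 3)%N & exact_period (fun z => z ^+ 2 + c) n q.
Proof.
move=> poonen /periodic_point_exact[n [n_gt0 fq min_n]].
exists n => //; rewrite leqNgt; apply/negP=> n_ge4.
pose p : {poly rat} := 'X^2 + c%:P.
have sz : size p = 3%N by rewrite size_polyDl ?size_polyXn // size_polyC; case: eqP.
apply: (poonen n n_ge4 p sz); exists q.
have iterE k : iter k (horner p) q = iter k (fun z => z ^+ 2 + c) q.
  by apply: eq_iter => z; rewrite /p !hornerE.
by split=> // [|k]; rewrite iterE //; apply: min_n.
Qed.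

Lemma period_le3_cases (c q : rat) (n : nat) : (n <= 3)%N ->
  exact_period (fun z => z ^+ 2 + c) n q ->
  [\/ c = q - q ^+ 2, c = - q ^+ 2 - q - 1
    | let t := q + q ^+ 2 + c in
      t ^+ 3 + (2 - 2 * q) * t ^+ 2 + (2 - 2 * q - 1) * t + 1 = 0].
Proof.
move=> n_le3 [n_gt0 fq _].
have [c1|/eqP nfix] := eqVneq c (q - q ^+ 2); first by constructor 1.
have {}nfix : q ^+ 2 + c != q by apply/eqP=> E; apply: nfix; lra.
case: n n_gt0 n_le3 fq => [|[|[|[|]]]] //= _ _ fq.
- by rewrite fq eqxx in nfix.
- constructor 2.
  (* [f^2(q) - q] factors as [(f(q) - q) (f(q) + q + 1)]. *)
  have /eqP : (q ^+ 2 + c - q) * (q ^+ 2 + c + q + 1) = 0.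
    by transitivity ((q ^+ 2 + c) ^+ 2 + c - q); [ring | rewrite fq subrr].
  by rewrite mulf_eq0 subr_eq0 (negPf nfix) => /eqP E; lra.
by constructor 3; have := period3_trace_root nfix fq; rewrite /= addrA.
Qed.

Theorem theorem5p1 (poonen : poonen_conjecture)
    (m : nat) (c : 'I_m -> rat) (c_inj : injective c)
    (q_ex : exists q : rat, forall i : 'I_m,
       periodic_point (fun z : rat => z ^+ 2 + c i) q) :
  (m <= 3)%N.
Proof.
case: q_ex => q per_q.
(* Pigeonhole: [g i] is one less than the period of [q] under the map of index [i], and each period
   allows a single value of [c i]. *)
pose g (i : 'I_m) : 'I_3 :=
  if c i == q - q ^+ 2 then 0 else if c i == - q ^+ 2 - q - 1 then 1 else 2.
suff g_inj : injective g by have := leq_card g g_inj; rewrite !card_ord.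
have cases i := let: ex_intro2 n n_le3 per := poonen_period_le3 poonen (per_q i)
  in period_le3_cases n_le3 per.
move=> i j gij; apply: c_inj; move: gij; rewrite /g.
have [-> |i1] := eqVneq (c i); have [-> |j1] := eqVneq (c j) => //.
- by case: eqP.
- by case: eqP.
have [-> |i2] := eqVneq (c i); have [-> |j2] := eqVneq (c j) => // _.
have root3 k : c k != q - q ^+ 2 -> c k != - q ^+ 2 - q - 1 ->
    let t := q + q ^+ 2 + c k in
    t ^+ 3 + (2 - 2 * q) * t ^+ 2 + (2 - 2 * q - 1) * t + 1 = 0.
  by move=> k1 k2; case: (cases k) => // E; rewrite E eqxx in k1 k2.
(* Both trace roots solve the same cubic, so they agree, and cancelling [q + q^2] leaves
   [c i = c j]. *)
exact: addrI (cubic_unique_root (root3 i i1 i2) (root3 j j1 j2)).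
Qed.
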